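(* Let $\mathcal{R}$ be a finite family of $n$ closed axis-parallel rectangles in the plane in general position, and let $\nu(\mathcal{R})$ denote its packing number. Then for every integer $k \geq 0$, the $(\leq k)$-level complexity of $\mathcal{R}$ is $O(kn + k^2 \nu(\mathcal{R})^2)$. In particular, the union complexity of $\mathcal{R}$ is $O(n + \nu(\mathcal{R})^2)$.
   Context: The packing number $\nu(\mathcal{R})$ is the maximum number of pairwise disjoint rectangles in $\mathcal{R}$; equivalently, $\nu(\mathcal{R}) = p-1$ means that among any $p$ rectangles of $\mathcal{R}$ some two have non-empty intersection, while some $p-1$ are pairwise disjoint. General position means no two rectangles have more than 4 common boundary points (no two rectangles share a segment of boundary, hence no three boundaries pass through a common point). A vertex is an intersection point of the boundaries of two rectangles of $\mathcal{R}$. The depth of a point is the number of rectangles of $\mathcal{R}$ containing it in their interior. The $(\leq k)$-level complexity of $\mathcal{R}$ is the number of vertices of depth at most $k$; the union complexity is the number of vertices of depth $0$ (i.e. vertices on the boundary of the union). The implied constants in $O(\cdot)$ are absolute.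
   Formalization: At k = 0 the stated bound kn + k²ν² is 0, which is false (two crossing rectangles have 4 vertices of depth 0), so the factor k is replaced by max(k,1): for k ≥ 1 the bound is as stated, and for k = 0 it is O(n + ν²). *)

(* Defs.v *)
From HB Require Import structures.
From mathcomp Require Import all_boot all_order all_algebra.
From mathcomp Require Import all_classical all_reals all_analysis.
Set Implicit Arguments.
Unset Strict Implicit.
Unset Printing Implicit Defensive.
Import Order.TTheory GRing.Theory Num.Theory.
Import numFieldNormedType.Exports.
Local Open Scope classical_set_scope.
Local Open Scope card_scope.
Local Open Scope ring_scope.

Record rectangle (R : realType) := Rectangle {
  xmin : R;
  xmax : R;
  ymin : R;
  ymax : R;
  xmin_lt_xmax : xmin < xmax;
  ymin_lt_ymax : ymin < ymax }.

Definition rect_set (R : realType) (r : rectangle R) : set (R * R) :=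
  `[xmin r, xmax r] `*` `[ymin r, ymax r].

Definition boundary (T : topologicalType) (A : set T) : set T :=
  closure A `\` interior A.

Section Family.
Variables (R : realType) (n : nat) (F : 'I_n -> rectangle R).

(* Two members with the same underlying set would have infinitely many common
   boundary points, so a family in general position is injective. *)
Definition general_position : Prop :=
  forall i j : 'I_n, i != j ->
    boundary (rect_set (F i)) `&` boundary (rect_set (F j)) #<= `I_4.

Definition packing_number : nat :=
  \max_(A : {set 'I_n} |
        `[< trivIset [set` A] (fun i => rect_set (F i)) >]) #|A|.

Definition is_vertex (p : R * R) : Prop :=
  exists i j : 'I_n,
    [/\ i != j, boundary (rect_set (F i)) p & boundary (rect_set (F j)) p].

Definition depth (p : R * R) : nat :=
  #|[pred i : 'I_n | `[< interior (rect_set (F i)) p >]]|.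

Definition level_vertices (k : nat) : set (R * R) :=
  [set p | is_vertex p /\ (depth p <= k)%N].

Definition union_vertices : set (R * R) :=
  [set p | is_vertex p /\ depth p = 0%N].

End Family.

(* Main.v *)
Require Import Defs.
From mathcomp Require Import all_boot all_order all_algebra.
From mathcomp Require Import all_classical all_reals all_analysis.
From mathcomp Require Import lra zify.
Import Order.TTheory GRing.Theory Num.Theory.
Import numFieldNormedType.Exports.
Set Implicit Arguments.
Unset Strict Implicit.
Unset Printing Implicit Defensive.

(** Apart from the at most 4n rectangle corners, every vertex is the crossing of
    a horizontal side of some A with a vertical side of some B; up to reflections
    it is p = (xmax B, ymax A).

    Union vertices.  The B's whose right sides meet the top side of a fixed A in
    a union vertex have pairwise disjoint x-ranges.  Hence at most one of them
    contains the left end of the top side, and only one gives the rightmost union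
    vertex on it; discard these at most 2n vertices.  Let f(B) be the maximal
    number of rectangles with pairwise disjoint x-ranges and xmax at most xmax B,
    and let g(A) be the analogue for y.  Both take values in {1, ..., nu}, and
    equal values force intersecting ranges.  Two surviving vertices (A, B) and
    (A', B') with xmax B <= xmax B' cannot have f(B) = f(B') and g(A) = g(A'):
    the vertex to the right of (A, B) on the top side of A comes from a B'' with
    f(B'') > f(B'), so the top side of A extends beyond xmax B', while that of A'
    extends to the left of xmax B; since A and A' meet in the y-direction, one of
    them covers the vertex lying on the lower of the two top sides.  This leaves
    at most nu^2 vertices.

    Levels.  The Clarkson-Shor sampling argument applies, because the packing
    number does not increase when passing to a subfamily. *)

(** * Sampling by random colourings *)

(** The colours on [S] are forced and all others are free; the count is multiplied out to avoid
    division. *)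
Lemma card_ffun_constant_on (I : finType) (q : nat) (S : {set I}) :
  #|[set c : {ffun I -> 'I_q.+1} | [forall i in S, c i == ord0]]| * q.+1 ^ #|S| =
  q.+1 ^ #|I|.
Proof.
pose P i : pred 'I_q.+1 := if i \in S then pred1 ord0 else predT.
have -> : #|[set c : {ffun I -> 'I_q.+1} | [forall i in S, c i == ord0]]| =
    #|family P|.
  apply: eq_card => c; rewrite inE; apply/forall_inP/familyP => [h i|h i iS].
    by rewrite /P; case: ifP => // iS; rewrite inE h.
  by have := h i; rewrite /P iS inE.
rewrite card_family foldrE big_map big_enum /=.
have -> : \prod_(i : I) #|P i| = q.+1 ^ #|~: S|.
  rewrite -prod_nat_const [RHS]big_mkcond /=; apply: eq_bigr => i _.
  by rewrite inE /P; case: (i \in S); rewrite /= ?card1 // card_ord.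
by rewrite -expnD addnC cardsC.
Qed.

(* Clarkson-Shor: sample with probability 1/(2K) by keeping one colour class of
   a uniformly random 2K-colouring.  An element of V with conflict set of size at
   most K survives with probability at least (2K)^-2 * (1 - K/(2K)). *)
Lemma sampling_bound (I : finType) (V : {set I * I}) (D : I * I -> {set I})
    (K a b : nat) :
  0 < K ->
  (forall e, e \in V -> [/\ e.1 != e.2, e.1 \notin D e, e.2 \notin D e & #|D e| <= K]) ->
  (forall T : {set I},
     #|[set e in V | [&& e.1 \in T, e.2 \in T & [disjoint D e & T]]]| <= a * #|T| + b) ->
  #|V| <= 4 * K * a * #|I| + 8 * K ^ 2 * b.
Proof.
move=> K0 VD VT.
have [q qE] : exists q, 2 * K = q.+1 by exists (2 * K).-1; rewrite prednK ?muln_gt0.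
pose colouring := {ffun I -> 'I_q.+1}.
pose N := q.+1 ^ #|I|.
have N0 : 0 < N by rewrite expn_gt0.
have cardN : #|colouring| = N by rewrite card_ffun card_ord.
(* The sample is the class of colour [ord0], and [mono S] is the event that it contains [S]. *)
pose T (c : colouring) := [set i | c i == ord0].
pose mono (S : {set I}) := [set c : colouring | [forall i in S, c i == ord0]].
have mono_sub S c : (c \in mono S) = (S \subset T c).
  by rewrite inE; apply/forall_inP/fintype.subsetP => h i /h; rewrite inE.
have monoE S : #|mono S| * q.+1 ^ #|S| = N by exact: card_ffun_constant_on.
(* The expected sample size is [#|I| / q.+1], here with denominators cleared. *)
have sumT : (\sum_(c : colouring) #|T c|) * q.+1 = #|I| * N.
  have -> : \sum_(c : colouring) #|T c| = \sum_(i : I) #|mono [set i]|.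
    under eq_bigr do rewrite -sum1_card big_mkcond /=.
    rewrite exchange_big; apply: eq_bigr => i _.
    rewrite -big_mkcond -sum1_card; apply: eq_bigl => c /=.
    by rewrite mono_sub finset.sub1set.
  rewrite big_distrl -sum_nat_const; apply: eq_bigr => i _ /=.
  by have := monoE [set i]; rewrite cards1 expn1.
pose good e := [set c | [&& e.1 \in T c, e.2 \in T c & [disjoint D e & T c]]].
(* Union bound: from the colourings that keep both ends of [e], remove those that also keep some [d]
   in [D e]. Since [K / q.+1 = 1/2], at least half of them remain. *)
have good_lb e : e \in V -> N <= 2 * q.+1 ^ 2 * #|good e|.
  case/VD; case: e => x y /= xy xD yD DK.
  have e2 : #|[set x; y]| = 2 by rewrite cards2 xy.
  have cover : mono [set x; y] \subset
      good (x, y) :|: \bigcup_(d in D (x, y)) mono (d |: [set x; y]).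
    apply/fintype.subsetP => c; rewrite mono_sub => xyT; rewrite !inE /=.
    have [xT yT] : c x == ord0 /\ c y == ord0.
      by move: xyT => /fintype.subsetP h; split; [have := h x|have := h y]; rewrite !inE eqxx ?orbT => /(_ isT).
    rewrite xT yT /=; case: (boolP [disjoint _ & _]) => //= /pred0Pn[d /= /andP[dD dT]].
    by apply/bigcupP; exists d; rewrite // mono_sub finset.subUset finset.sub1set dT.
  have le1 : #|mono [set x; y]| <= #|good (x, y)| +
      \sum_(d in D (x, y)) #|mono (d |: [set x; y])|.
    apply: leq_trans (subset_leq_card cover) _.
    apply: leq_trans (leq_card_setU _ _) _.
    rewrite leq_add2l.
    elim/big_rec2: _ => [|d m A _ IH]; first by rewrite cards0.
    by apply: leq_trans (leq_card_setU _ _) _; rewrite leq_add2l.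
  have le2 : (\sum_(d in D (x, y)) #|mono (d |: [set x; y])|) * q.+1 ^ 3 <= K * N.
    apply: leq_trans (leq_mul DK (leqnn N)).
    rewrite big_distrl -sum_nat_const; apply: leq_sum => d dD /=.
    have dxy : d \notin [set x; y].
      rewrite !inE; apply/negP => /orP[]/eqP dE; subst d.
        by rewrite dD in xD.
      by rewrite dD in yD.
    by have := monoE (d |: [set x; y]); rewrite cardsU1 dxy e2 => ->.
  have := monoE [set x; y]; rewrite e2 => m2.
  move: le1 le2; set s := \sum_(d in _) _; set g := #|good _|; set m := #|_| in m2 * => le1 le2.
  rewrite -(leq_pmul2l (m := K)) //.
  have e1 : m * q.+1 ^ 3 = 2 * K * N by rewrite expnSr mulnA m2 qE mulnC.
  have : m * q.+1 ^ 3 <= (g + s) * q.+1 ^ 3 by rewrite leq_mul2r le1 orbT.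
  rewrite mulnDl => e3.
  have -> : K * (2 * q.+1 ^ 2 * g) = g * q.+1 ^ 3 by rewrite [q.+1 ^ 3]expnSr -{3}qE; lia.
  by lia.
rewrite -(leq_pmul2r (m := N)) //.
have step1 : #|V| * N <= 2 * q.+1 ^ 2 * \sum_(e in V) #|good e|.
  by rewrite -sum_nat_const big_distrr /=; apply: leq_sum => e; exact: good_lb.
have step2 : \sum_(e in V) #|good e| <= a * (\sum_(c : colouring) #|T c|) + N * b.
  under eq_bigr do rewrite -sum1_card big_mkcond /=.
  rewrite exchange_big /= big_distrr /= -cardN -sum_nat_const -big_split /=.
  apply: leq_sum => c _; apply: leq_trans (VT (T c)).
  rewrite -big_mkcondr sum1_card subset_leq_card //.
  by apply/fintype.subsetP => e; rewrite !inE unfold_in !inE.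
apply: leq_trans step1 _.
apply: leq_trans (leq_mul (leqnn _) step2) _.
(* One factor [q.+1] is absorbed by [sumT]; the remaining ones become [2 * K]. *)
have -> : 2 * q.+1 ^ 2 * (a * (\sum_(c : colouring) #|T c|) + N * b) =
  2 * q.+1 * a * ((\sum_(c : colouring) #|T c|) * q.+1) + 2 * q.+1 ^ 2 * N * b by lia.
by rewrite sumT -qE; lia.
Qed.

(** * Ranking intervals by disjoint subfamilies *)

(** Take [f i] to be one less than the largest size of a pairwise disjoint subfamily whose right
    ends are at most [r i]. An interval starting after [r i] can be added to a witness for [i],
    which gives strictness. *)
Lemma interval_rank (R : realType) (I : finType) (l r : I -> R) (m : nat) :
  (forall i, l i < r i)%R ->
  (forall S : {set I}, {in S &, forall i j, i != j -> (r i < l j) || (r j < l i)}%R ->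
    (#|S| <= m)%N) ->
  exists f : I -> nat,
    [/\ forall i, (f i < m)%N,
        forall i j, (r i <= r j)%R -> (f i <= f j)%N &
        forall i j, (r i < l j)%R -> (f i < f j)%N].
Proof.
move=> lr sep_m.
pose sep (S : {set I}) := [forall i in S, forall j in S,
  (i != j) ==> ((r i < l j) || (r j < l i))%R].
have sepP (S : {set I}) : reflect {in S &, forall i j, i != j -> (r i < l j) || (r j < l i)}%R
    (sep S).
  apply: (iffP forall_inP) => [h i j iS jS ij|h i iS].
    by have /forall_inP/(_ j jS)/implyP := h i iS; apply.
  by apply/forall_inP => j jS; apply/implyP; exact: h.
pose g i := (\max_(S : {set I} | sep S && [forall j in S, (r j <= r i)%R]) #|S|)%N.
have g_witness i : exists2 S : {set I}, sep S && [forall j in S, (r j <= r i)%R] & g i = #|S|.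
  pose A : pred {set I} := fun S => sep S && [forall j in S, (r j <= r i)%R].
  have A0 : (0 < #|A|)%N.
    by apply/card_gt0P; exists finset.set0; apply/andP; split; apply/forall_inP => j; rewrite inE.
  have [S AS gS] := eq_bigmax_cond (fun S : {set I} => #|S|) A0.
  by exists S; rewrite // -gS; apply: eq_bigl.
have g_ge i (S : {set I}) : sep S -> (forall j, j \in S -> (r j <= r i)%R) -> (#|S| <= g i)%N.
  move=> sS rS; by apply: (@leq_bigmax_cond {set I} _ (fun S => #|S|)); rewrite sS; apply/forall_inP.
have g_gt0 i : (0 < g i)%N.
  rewrite -(cards1 i); apply: g_ge => [|j /set1P-> //].
  by apply/sepP => a b /set1P-> /set1P->; rewrite eqxx.
exists (fun i => (g i).-1); split=> [i|i j rij|i j rlij].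
- rewrite prednK //; have [S /andP[/sepP sS _] ->] := g_witness i.
  exact: sep_m.
- rewrite -ltnS !prednK //; have [S /andP[sS /forall_inP rS] ->] := g_witness i.
  by apply: g_ge => // a aS; apply: le_trans rij; exact: rS.
- rewrite prednK //; have [S /andP[/sepP sS /forall_inP rS] gS] := g_witness i.
  have jS : j \notin S.
    apply/negP => /rS; rewrite leNgt => /negP; apply.
    exact: lt_trans rlij (lr j).
  have := g_ge j (j |: S)%SET; rewrite cardsU1 jS add1n -gS.
  move=> h; rewrite -ltnS prednK //; apply: h.
    apply/sepP => a b /setU1P[->|aS] /setU1P[->|bS]; rewrite ?eqxx //.
    + by move=> _; rewrite (le_lt_trans (rS _ bS) rlij) orbT.
    + by move=> _; rewrite (le_lt_trans (rS _ aS) rlij).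
    + exact: sS.
  move=> a /setU1P[->//|aS].
  by apply/ltW/(le_lt_trans (rS _ aS))/(lt_trans rlij).
Qed.

(** * Rectangles and general position in coordinates *)

Local Open Scope classical_set_scope.
Local Open Scope card_scope.

(** Boolean, so that the rectangles covering a point form a finite set. *)
Definition inside (R : realType) (r : rectangle R) (p : R * R) : bool :=
  ((xmin r < p.1 < xmax r) && (ymin r < p.2 < ymax r))%R.

Lemma interior_rect_set (R : realType) (r : rectangle R) (p : R * R) :
  interior (rect_set r) p <-> inside r p.
Proof.
rewrite /rect_set /inside; case: p => x y /=; split.
  case=> -[A B] /= [Ax By] AB.
  have : (`[xmin r, xmax r]°)%classic x.
    apply: filterS Ax => z Az; have := AB (z, y); case=> //; split => //=.
    exact: nbhs_singleton.
  have : (`[ymin r, ymax r]°)%classic y.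
    apply: filterS By => z Bz; have := AB (x, z); case=> //; split => //=.
    exact: nbhs_singleton.
  by rewrite !interior_itv /= !in_itv /= => -> ->.
case/andP => hx hy; exists (`[xmin r, xmax r], `[ymin r, ymax r]) => //=.
split; [have : (`[xmin r, xmax r]°)%classic x | have : (`[ymin r, ymax r]°)%classic y] => //;
by rewrite interior_itv /= in_itv.
Qed.

Lemma boundary_rect_set (R : realType) (r : rectangle R) (p : R * R) :
  boundary (rect_set r) p <-> rect_set r p /\ ~~ inside r p.
Proof.
have -> : boundary (rect_set r) = rect_set r `\` interior (rect_set r).
  rewrite /boundary; congr (_ `\` _); apply/esym/closure_id.
  have -> : rect_set r = fst @^-1` `[xmin r, xmax r] `&` snd @^-1` `[ymin r, ymax r] by [].
  apply: closedI; apply: closed_comp; try exact: itv_closed; move=> q _;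
    [exact: cvg_fst|exact: cvg_snd].
split=> -[h1 h2]; split=> //; first by apply/negP => /interior_rect_set.
by move=> /interior_rect_set; apply/negP.
Qed.

Lemma five_points_on_segment (R : realType) (A : set (R * R)) (f : R -> R * R) (l u : R) :
  (l < u)%R -> injective f -> (forall t, (l <= t <= u)%R -> A (f t)) -> ~ (A #<= `I_4).
Proof.
move=> lu finj fA A4.
pose g (k : nat) := f (l + (u - l) * (k%:R / 4%:R))%R.
have ginj : injective g.
  move=> i j /finj /addrI /mulfI; rewrite subr_eq0 gt_eqF // => /(_ isT).
  have n4 : (4%:R != 0 :> R)%R by rewrite pnatr_eq0.
  by move=> /(divIf n4)/eqP; rewrite eqr_nat => /eqP.
have : `I_5 #<= `I_4.
  apply: card_le_trans A4.
  have /card_eqPle[_ h] : g @` `I_5 #= `I_5 by apply: inj_card_eq => ? ? _ _; exact: ginj.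
  apply: card_le_trans h _; apply: subset_card_le => _ [k /= k5 <-]; apply: fA.
  have k4 : (k%:R <= 4%:R :> R)%R by rewrite ler_nat.
  have k0 : (0 <= k%:R :> R)%R by rewrite ler0n.
  have : (0 <= k%:R / 4%:R :> R)%R by rewrite divr_ge0.
  have : (k%:R / 4%:R <= 1 :> R)%R by rewrite ler_pdivrMr ?mul1r.
  by move=> h1 h2; apply/andP; split; nra.
by rewrite card_le_II.
Qed.

(** General position as the counting uses it: sides of different rectangles on a common line overlap
    in at most a point. This form passes easily to reflected families. *)
Definition no_shared_side (R : realType) (I : finType) (F : I -> rectangle R) : Prop :=
  forall i j, i != j ->
  (forall a : R, a \in [:: xmin (F i); xmax (F i)] -> a \in [:: xmin (F j); xmax (F j)] ->
     ymax (F i) <= ymin (F j) \/ ymax (F j) <= ymin (F i))%R /\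
  (forall a : R, a \in [:: ymin (F i); ymax (F i)] -> a \in [:: ymin (F j); ymax (F j)] ->
     xmax (F i) <= xmin (F j) \/ xmax (F j) <= xmin (F i))%R.

(** A nondegenerate overlap of two collinear sides would lie in both boundaries and supply five
    common points. *)
Lemma general_position_no_shared_side (R : realType) (n : nat) (F : 'I_n -> rectangle R) :
  general_position F -> no_shared_side F.
Proof.
have vert (r : rectangle R) (a t : R) : a \in [:: xmin r; xmax r] ->
    (ymin r <= t <= ymax r)%R -> boundary (rect_set r) (a, t).
  have rx := xmin_lt_xmax r; move=> ha ht; apply/boundary_rect_set.
  rewrite /rect_set /inside /= !in_itv /=; move: ha; rewrite !inE => /orP[]/eqP->;
  by rewrite ht lexx ltxx ?andbF /= ltW.
have hor (r : rectangle R) (a t : R) : a \in [:: ymin r; ymax r] ->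
    (xmin r <= t <= xmax r)%R -> boundary (rect_set r) (t, a).
  have ry := ymin_lt_ymax r; move=> ha ht; apply/boundary_rect_set.
  rewrite /rect_set /inside /= !in_itv /=; move: ha; rewrite !inE => /orP[]/eqP->;
  by rewrite ht lexx ltxx ?andbF /= ltW.
move=> gp i j ij; split => a ai aj; apply/orP; apply: contraT; rewrite negb_or -!ltNge.
- move=> /andP[h1 h2]; exfalso.
  apply: (@five_points_on_segment R _ (fun t => (a, t))
     (Num.max (ymin (F i)) (ymin (F j))) (Num.min (ymax (F i)) (ymax (F j)))) (gp i j ij).
  + by rewrite gt_max !lt_min h1 h2 !ymin_lt_ymax.
  + by move=> t t' [].
  + move=> t; rewrite ge_max le_min => /andP[/andP[t1 t2] /andP[t3 t4]].
    by split; apply: vert => //; apply/andP.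
- move=> /andP[h1 h2]; exfalso.
  apply: (@five_points_on_segment R _ (fun t => (t, a))
     (Num.max (xmin (F i)) (xmin (F j))) (Num.min (xmax (F i)) (xmax (F j)))) (gp i j ij).
  + by rewrite gt_max !lt_min h1 h2 !xmin_lt_xmax.
  + by move=> t t' [].
  + move=> t; rewrite ge_max le_min => /andP[/andP[t1 t2] /andP[t3 t4]].
    by split; apply: hor => //; apply/andP.
Qed.

(** * Crossings open to the north-east *)

Definition x_apart (R : realType) (r s : rectangle R) : bool :=
  ((xmax r < xmin s) || (xmax s < xmin r))%R.
Definition y_apart (R : realType) (r s : rectangle R) : bool :=
  ((ymax r < ymin s) || (ymax s < ymin r))%R.

(** Packings separated along a single axis suffice, since one rank uses only x-ranges and the other
    only y-ranges. *)
Definition apart_bound (R : realType) (I : finType) (F : I -> rectangle R) (nu : nat) : Prop :=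
  forall S : {set I},
    {in S &, forall i j, i != j -> x_apart (F i) (F j)} \/
    {in S &, forall i j, i != j -> y_apart (F i) (F j)} -> #|S| <= nu.

Definition ne_corner (R : realType) (A B : rectangle R) : R * R := (xmax B, ymax A).

(* "ne": near this crossing, A and B leave only the north-east quadrant uncovered. *)
Definition ne_crossing (R : realType) (A B : rectangle R) : bool :=
  ((xmin A < xmax B < xmax A) && (ymin B < ymax A < ymax B))%R.

(** The conflict set of the sampling argument; its size is the depth of the crossing. *)
Definition ne_cover (R : realType) (I : finType) (F : I -> rectangle R) (e : I * I) : {set I} :=
  [set c | inside (F c) (ne_corner (F e.1) (F e.2))]%SET.

Definition ne_pairs (R : realType) (I : finType) (F : I -> rectangle R) : {set I * I} :=
  [set e | ne_crossing (F e.1) (F e.2)]%SET.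

Lemma card_fst_inj (I J : finType) (E : {set I * J}) (T : {set I}) :
  (forall e, e \in E -> e.1 \in T) ->
  {in E &, forall e e', e.1 = e'.1 -> e = e'} -> #|E| <= #|T|.
Proof.
move=> ET inj; rewrite -(card_in_imset (f := fst) (D := E)) //.
by apply/subset_leq_card/fintype.subsetP => _ /imsetP[e eE ->]; exact: ET.
Qed.

Lemma card_rank_inj (I : finType) (E : {set I}) (m : nat) (f g : I -> nat) :
  (forall i, f i < m) -> (forall i, g i < m) ->
  {in E &, forall e e', f e = f e' -> g e = g e' -> e = e'} -> #|E| <= m ^ 2.
Proof.
move=> fm gm inj.
pose h i := (Ordinal (fm i), Ordinal (gm i)).
rewrite -(card_in_imset (f := h) (D := E)).
  by rewrite (leq_trans (max_card _)) // card_prod card_ord.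
by move=> i j iE jE [fij gij]; exact: inj.
Qed.

Section NECount.
Variables (R : realType) (I : finType) (F : I -> rectangle R) (nu : nat) (T : {set I}).
Hypotheses (gpF : no_shared_side F) (apF : apart_bound F nu).

(** The union vertices of north-east type in the subfamily [T]. *)
Let E := [set e in ne_pairs F | [&& e.1 \in T, e.2 \in T & [disjoint ne_cover F e & T]]]%SET.

Let crossE e : e \in E ->
  [/\ xmin (F e.1) < xmax (F e.2), xmax (F e.2) < xmax (F e.1),
      ymin (F e.2) < ymax (F e.1) & ymax (F e.1) < ymax (F e.2)]%R.
Proof. by rewrite !inE => /andP[/andP[/andP[-> ->] /andP[-> ->]] _]. Qed.

Let inT e : e \in E -> e.1 \in T /\ e.2 \in T.
Proof. by rewrite !inE => /and4P[_ -> -> _]. Qed.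

Let visible e c : e \in E -> c \in T ->
  ~ [/\ xmin (F c) < xmax (F e.2), xmax (F e.2) < xmax (F c),
      ymin (F c) < ymax (F e.1) & ymax (F e.1) < ymax (F c)]%R.
Proof.
rewrite inE => /and4P[_ _ _ /pred0P/(_ c)] /=; rewrite inE /inside /= => h cT [h1 h2 h3 h4].
by move: h; rewrite cT h1 h2 h3 h4.
Qed.

(** Were the x-ranges to overlap, the rectangle reaching further right would contain the other
    crossing in its interior. Ranges that merely touch are excluded by general position. *)
Let same_top e e' : e \in E -> e' \in E -> e.1 = e'.1 ->
  [\/ e = e', (xmax (F e.2) < xmin (F e'.2))%R | (xmax (F e'.2) < xmin (F e.2))%R].
Proof.
case: e e' => a b [a' b'] eE eE' /= aa'; subst a'.
have [|bb'] := eqVneq b b'; first by move=> ->; constructor 1.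
have [gpx _] := gpF bb'.
have /= [h1 h2 h3 h4] := crossE eE; have /= [h1' h2' h3' h4'] := crossE eE'.
have /= [_ bT] := inT eE; have /= [_ bT'] := inT eE'.
have [lt|gt|eq] := ltgtP (xmax (F b)) (xmax (F b')).
- have [?|gt|eq] := ltgtP (xmax (F b)) (xmin (F b')); first by constructor 2.
    by case: (visible eE bT').
  by have := gpx (xmax (F b)); rewrite !inE eqxx eq eqxx !orbT => /(_ isT isT); lra.
- have [?|gt'|eq] := ltgtP (xmax (F b')) (xmin (F b)); first by constructor 3.
    by case: (visible eE' bT).
  by have := gpx (xmax (F b')); rewrite !inE eqxx eq eqxx !orbT => /(_ isT isT); lra.
- by have := gpx (xmax (F b)); rewrite !inE eqxx eq eqxx !orbT => /(_ isT isT); lra.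
Qed.

Lemma card_visible_ne_pairs : #|E| <= 2 * #|T| + nu ^ 2.
Proof.
(* Both ranks are taken in the whole family, so [nu] bounds them for every [T]. *)
have [||f [f_lt f_mono f_strict]] :=
    @interval_rank R I (fun i => xmin (F i)) (fun i => xmax (F i)) nu.
- by move=> i; exact: xmin_lt_xmax.
- by move=> S apS; apply: apF; left.
have [||g [g_lt g_mono g_strict]] :=
    @interval_rank R I (fun i => ymin (F i)) (fun i => ymax (F i)) nu.
- by move=> i; exact: ymin_lt_ymax.
- by move=> S apS; apply: apF; right.
(* [EL]: the vertical rectangle contains the left end of the top side. [ER]: no crossing of [E] lies
   further right on that side. By [same_top], each occurs at most once per top side. *)
pose EL := [set e in E | (xmin (F e.2) <= xmin (F e.1))%R]%SET.
pose right_of e := [exists e' in E, (e'.1 == e.1) && (xmax (F e.2) < xmax (F e'.2))%R].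
pose ER := [set e in E | ~~ right_of e]%SET.
pose E0 := E :\: (EL :|: ER).
have cardL : #|EL| <= #|T|.
  apply: card_fst_inj => [e|e e'].
    by rewrite inE => /andP[/inT[]].
  rewrite inE => /andP[eE hl]; rewrite inE => /andP[eE' hl'] e1.
  have [h1 _ _ _] := crossE eE; have [h1' _ _ _] := crossE eE'.
  have [//|lt|lt] := same_top eE eE' e1; exfalso; rewrite -e1 in h1' hl'; clear e1; lra.
have cardR : #|ER| <= #|T|.
  apply: card_fst_inj => [e|e e'].
    by rewrite inE => /andP[/inT[]].
  rewrite inE => /andP[eE hr]; rewrite inE => /andP[eE' hr'] e1.
  have [//|lt|lt] := same_top eE eE' e1; exfalso.
    move/negP: hr; apply; apply/exists_inP; exists e' => //; rewrite e1 eqxx /=.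
    exact: lt_trans lt (xmin_lt_xmax _).
  move/negP: hr'; apply; apply/exists_inP; exists e => //; rewrite e1 eqxx /=.
  exact: lt_trans lt (xmin_lt_xmax _).
have card0 : #|E0| <= nu ^ 2.
  apply: (@card_rank_inj _ E0 nu (fun e => f e.2) (fun e => g e.1)) => // e e'.
  have E0P e0 : e0 \in E0 -> [/\ e0 \in E, (xmin (F e0.1) < xmin (F e0.2))%R & right_of e0].
    case/setDP => h3 /setUP h; split=> //.
      by rewrite ltNge; apply/negP => le; apply: h; left; rewrite inE h3.
    by apply: contraT => nr; case: h; right; rewrite inE h3.
  move=> /E0P[eE cr rt] /E0P[eE' cr' rt'].
  wlog le : e e' eE cr rt eE' cr' rt' / (xmax (F e.2) <= xmax (F e'.2))%R.
    move=> hw ff gg; have [le|/ltW le] := leP (xmax (F e.2)) (xmax (F e'.2)).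
      exact: hw.
    by apply/esym/hw.
  move=> ff gg.
  (* Together with [cr'], this puts the left end of the top side of [e'.1] strictly to the left of
     the crossing [e]. *)
  have meet_x : (xmin (F e'.2) <= xmax (F e.2))%R.
    by rewrite leNgt; apply/negP => /f_strict; rewrite ff ltnn.
  have meet_y : (ymin (F e.1) <= ymax (F e'.1) /\ ymin (F e'.1) <= ymax (F e.1))%R.
    by split; rewrite leNgt; apply/negP => /g_strict; rewrite gg ltnn.
  have [h1 h2 h3 h4] := crossE eE; have [h1' h2' h3' h4'] := crossE eE'.
  have [aT bT] := inT eE; have [aT' bT'] := inT eE'.
  have [aa|aa] := eqVneq e.1 e'.1.
    by have [//|/f_strict|/f_strict] := same_top eE eE' aa; rewrite ff ltnn.
  have [_ gpy] := gpF aa.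
  have far : (xmax (F e'.2) < xmax (F e.1))%R.
    have /exists_inP[e'' eE'' /andP[/eqP e1 lt]] := rt.
    have [_ h2'' _ _] := crossE eE''; rewrite e1 in h2''.
    apply: lt_trans h2''.
    have [ee|lt'|lt'] := same_top eE eE'' (esym e1).
    - by rewrite -ee ltxx in lt.
    - rewrite ltNge; apply/negP => /f_mono; have := f_strict _ _ lt'.
      by rewrite ff => a b; have := leq_trans a b; rewrite ltnn.
    - by have := xmin_lt_xmax (F e.2); have := xmin_lt_xmax (F e''.2); lra.
  (* The x-ranges of both horizontal rectangles contain both corners, so
     whichever top side is higher, its rectangle covers the other corner. *)
  have gp1 : (ymax (F e.1) != ymax (F e'.1))%R.
    apply/eqP => eq; have := gpy (ymax (F e.1)); rewrite !inE eq eqxx !orbT => /(_ isT isT).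
    by lra.
  have gp2 : (ymin (F e.1) != ymax (F e'.1))%R.
    apply/eqP => eq; have := gpy (ymin (F e.1)); rewrite !inE eq eqxx !orbT => /(_ isT isT).
    by lra.
  have gp3 : (ymax (F e.1) != ymin (F e'.1))%R.
    apply/eqP => eq; have := gpy (ymax (F e.1)); rewrite !inE eq eqxx !orbT => /(_ isT isT).
    by lra.
  case: meet_y => my1 my2; exfalso.
  have [lt|gt|eq] := ltgtP (ymax (F e.1)) (ymax (F e'.1)); last by rewrite eq eqxx in gp1.
  - by case: (visible eE aT'); split; rewrite ?lt_neqAle ?(eq_sym (ymin _)) ?gp3 //; lra.
  - by case: (visible eE' aT); split; rewrite ?lt_neqAle ?gp2 //; lra.
have : E \subset (EL :|: ER) :|: E0.
  by apply/fintype.subsetP => e eE; rewrite finset.in_setU finset.in_setD eE andbT orbN.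
move/subset_leq_card/leq_trans; apply.
apply: leq_trans (leq_card_setU _ _) _; apply: leq_add card0.
by apply: leq_trans (leq_card_setU _ _) _; rewrite mul2n -addnn leq_add.
Qed.

End NECount.

(** Sampling with [a = 2] and [b = nu ^ 2], the coefficients of the bound for visible crossings. *)
Lemma card_ne_pairs (R : realType) (I : finType) (F : I -> rectangle R) (nu K : nat) :
  0 < K -> no_shared_side F -> apart_bound F nu ->
  #|[set e in ne_pairs F | #|ne_cover F e| <= K]%SET| <= 8 * K * #|I| + 8 * K ^ 2 * nu ^ 2.
Proof.
move=> K0 gpF apF.
have := @sampling_bound I [set e in ne_pairs F | #|ne_cover F e| <= K]%SET
  (ne_cover F) K 2 (nu ^ 2) K0.
have -> : 4 * K * 2 = 8 * K by rewrite mulnAC.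
apply.
- case=> a b; rewrite !inE /= => /andP[/andP[/andP[h1 h2] /andP[h3 h4]] ->].
  rewrite /inside /= ltxx !andbF /= ltxx andbF; split=> //.
  by apply/eqP => ab; rewrite ab ltxx in h2.
- move=> T; apply: leq_trans (card_visible_ne_pairs T gpF apF).
  by apply/subset_leq_card/fintype.subsetP => e; rewrite !inE => /andP[/andP[-> _] ->].
Qed.

(** * Reflections in the coordinate axes *)

Lemma ltr_opp2 (R : realType) (a b : R) : (a < b)%R -> (- b < - a)%R.
Proof. by rewrite ltrN2. Qed.

Definition mirror_x (R : realType) (r : rectangle R) : rectangle R :=
  Rectangle (ltr_opp2 (xmin_lt_xmax r)) (ymin_lt_ymax r).
Definition mirror_y (R : realType) (r : rectangle R) : rectangle R :=
  Rectangle (xmin_lt_xmax r) (ltr_opp2 (ymin_lt_ymax r)).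

Definition mirror (R : realType) (s : bool * bool) (r : rectangle R) : rectangle R :=
  let r' := if s.1 then mirror_x r else r in if s.2 then mirror_y r' else r'.

Definition mirror_point (R : realType) (s : bool * bool) (p : R * R) : R * R :=
  (if s.1 then - p.1 else p.1, if s.2 then - p.2 else p.2)%R.

Lemma inside_mirror (R : realType) (s : bool * bool) (r : rectangle R) (p : R * R) :
  inside (mirror s r) p = inside r (mirror_point s p).
Proof.
have flip (l u z : R) : ((- u < z < - l) = (l < - z < u))%R.
  by rewrite ltrNl ltrNr andbC.
by case: s => -[] []; rewrite /inside /= ?flip.
Qed.

Lemma no_shared_side_mirror (R : realType) (I : finType) (F : I -> rectangle R) s :
  no_shared_side F -> no_shared_side (fun i => mirror s (F i)).
Proof.
have mem_opp (a x y : R) : (a \in [:: - x; - y] -> - a \in [:: y; x])%R.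
  by rewrite !inE => /orP[]/eqP->; rewrite opprK eqxx ?orbT.
have x_case (F' : I -> rectangle R) :
    no_shared_side F' -> no_shared_side (fun i => mirror_x (F' i)).
  move=> h i j ij; have [hx hy] := h i j ij; split => a /= ai aj.
    by apply: (hx (- a)%R); exact: mem_opp.
  by have := hy a ai aj; rewrite !lerN2 => -[]; [right|left].
have y_case (F' : I -> rectangle R) :
    no_shared_side F' -> no_shared_side (fun i => mirror_y (F' i)).
  move=> h i j ij; have [hx hy] := h i j ij; split => a /= ai aj.
    by have := hx a ai aj; rewrite !lerN2 => -[]; [right|left].
  by apply: (hy (- a)%R); exact: mem_opp.
by case: s => -[] [] h //; do ?[apply: y_case]; do ?[apply: x_case].
Qed.

Lemma apart_bound_mirror (R : realType) (I : finType) (F : I -> rectangle R) nu s :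
  apart_bound F nu -> apart_bound (fun i => mirror s (F i)) nu.
Proof.
move=> h S hS; apply: h; case: hS => hS; [left|right] => i j iS jS ij.
all: by have := hS i j iS jS ij; case: s {hS} => -[] []; rewrite /x_apart /y_apart /= ?ltrN2 // orbC.
Qed.

(** * From boundary points to corners and crossings *)

Definition corners (R : realType) (r : rectangle R) : seq (R * R) :=
  [:: (xmin r, ymin r); (xmin r, ymax r); (xmax r, ymin r); (xmax r, ymax r)].

Lemma boundary_cases (R : realType) (r : rectangle R) (p : R * R) :
  boundary (rect_set r) p ->
  [\/ p \in corners r,
      p.1 \in [:: xmin r; xmax r] /\ (ymin r < p.2 < ymax r)%R |
      p.2 \in [:: ymin r; ymax r] /\ (xmin r < p.1 < xmax r)%R].
Proof.
case: p => x y /boundary_rect_set[]; rewrite /rect_set /inside /corners /= !in_itv /=.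
have xlr := xmin_lt_xmax r; have ylr := ymin_lt_ymax r.
move=> [/andP[/= x1 x2] /andP[/= y1 y2]].
move: x1 x2 y1 y2; rewrite !le_eqVlt.
(* If no inequality is an equality, the point is inside; equality in one coordinate only gives an
   open side, and in both a corner. *)
move=> /orP[/eqP xl|xl] /orP[/eqP xr|xr] /orP[/eqP yl|yl] /orP[/eqP yr|yr] h;
try subst x; try subst y;
first [by rewrite xl xr yl yr in h
  | by constructor 2; rewrite !inE yl yr eqxx ?orbT
  | by constructor 3; rewrite !inE xl xr eqxx ?orbT
  | by constructor 1; rewrite !inE !xpair_eqE !eqxx ?orbT
  | by lra].
Qed.

(** Reflect in x when [p] is on the left side of [B], and in y when it is on the bottom side of
    [A]. *)
Lemma crossing_mirror (R : realType) (A B : rectangle R) (p : R * R) :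
  p.2 \in [:: ymin A; ymax A] -> (xmin A < p.1 < xmax A)%R ->
  p.1 \in [:: xmin B; xmax B] -> (ymin B < p.2 < ymax B)%R ->
  exists s, ne_crossing (mirror s A) (mirror s B) /\
    p = mirror_point s (ne_corner (mirror s A) (mirror s B)).
Proof.
case: p => x y /=; rewrite !inE => hy /andP[x1 x2] /orP[]/eqP xB /andP[y1 y2];
case/orP: hy => /eqP yA; subst x y; [exists (true, true)|exists (true, false)|exists (false, true)|exists (false, false)];
by rewrite /ne_crossing /ne_corner /mirror_point /= ?opprK ?ltrN2 x1 x2 y1 y2.
Qed.

(** * Counting all vertices *)

Lemma card_le_seq (T : choiceType) (A : set T) (s : seq T) (m : nat) :
  A `<=` [set` s] -> (size s <= m)%N -> A #<= `I_m.
Proof.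
move=> As sm; apply: (card_le_trans (subset_card_le As)).
case: s sm {As} => [|x s] sm; first by rewrite set_nil card_ge0.
apply: (@card_le_trans _ _ _ (nth x (x :: s) @` `I_m)); last exact: card_image_le.
apply: subset_card_le => y /= ys; exists (index y (x :: s)); last exact: nth_index.
by apply: leq_trans sm; rewrite index_mem.
Qed.

Lemma apart_bound_packing_number (R : realType) (n : nat) (F : 'I_n -> rectangle R) :
  apart_bound F (packing_number F).
Proof.
move=> S hS; apply: (@leq_bigmax_cond {set 'I_n} _ (fun S => #|S|)); apply/asboolP.
move=> i j /= iS jS [[x y] [[/= xi yi] [/= xj yj]]]; move: xi yi xj yj; rewrite /= !in_itv /=.
move=> /andP[x1 x2] /andP[y1 y2] /andP[x3 x4] /andP[y3 y4].
apply/eqP; apply: contraT => ij.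
by case: hS => /(_ i j iS jS ij); rewrite /x_apart /y_apart; lra.
Qed.

(** The constant is [36 = 4 * 8 + 4]: each of the four reflections contributes 8, and the [4 * n]
    corners contribute 4. Using [maxn k 1] keeps the sampling parameter positive. *)
Lemma level_vertices_bound (R : realType) (n : nat) (F : 'I_n -> rectangle R) (k : nat) :
  general_position F ->
  level_vertices F k #<=
    `I_(36 * (maxn k 1 * n + maxn k 1 ^ 2 * packing_number F ^ 2)).
Proof.
move=> gp; have gpF := general_position_no_shared_side gp.
set K := maxn k 1; set nu := packing_number F.
have K0 : 0 < K by rewrite leq_max orbT.
pose G s i := mirror s (F i).
pose V s := [set e in ne_pairs (G s) | #|ne_cover (G s) e| <= K]%SET.
have cardV s : #|V s| <= 8 * (K * n) + 8 * (K ^ 2 * nu ^ 2).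
  rewrite (mulnA 8 K) (mulnA 8 (K ^ 2)); have := @card_ne_pairs R 'I_n (G s) nu K K0.
  rewrite card_ord; apply; first exact: no_shared_side_mirror.
  exact/apart_bound_mirror/apart_bound_packing_number.
pose vs s := [seq mirror_point s (ne_corner (G s e.1) (G s e.2)) | e <- enum (V s)].
pose cs := flatten [seq corners (F i) | i <- enum 'I_n].
apply: (@card_le_seq _ _ (vs (false, false) ++ vs (false, true) ++ vs (true, false) ++
  vs (true, true) ++ cs)); last first.
  have size_cs : size cs = 4 * n.
    rewrite -[n in RHS]card_ord cardE /cs; elim: (enum _) => //= a t IH.
    by rewrite IH mulnS.
  rewrite !size_cat !size_map -!cardE size_cs.
  have arith a b c d u v : a <= 8 * u + 8 * v -> b <= 8 * u + 8 * v ->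
      c <= 8 * u + 8 * v -> d <= 8 * u + 8 * v -> n <= u ->
      a + (b + (c + (d + 4 * n))) <= 36 * (u + v) by lia.
  by apply: arith; rewrite ?leq_pmull //; exact: cardV.
move=> p [[i [j [ij bi bj]]] dp] /=.
rewrite !mem_cat.
have cornerP a : p \in corners (F a) -> p \in cs.
  by move=> pa; apply/flatten_mapP; exists a; rewrite ?mem_enum.
have crossP a b : p.2 \in [:: ymin (F a); ymax (F a)] -> (xmin (F a) < p.1 < xmax (F a))%R ->
    p.1 \in [:: xmin (F b); xmax (F b)] -> (ymin (F b) < p.2 < ymax (F b))%R ->
    exists s, p \in vs s.
  move=> h1 h2 h3 h4; have [s [cr pE]] := crossing_mirror h1 h2 h3 h4.
  exists s; apply/mapP; exists (a, b); rewrite // mem_enum !inE cr /=.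
  (* Undoing the reflection, the conflict set consists of rectangles with [p] in their interior, so
     the depth of [p] bounds its size. *)
  apply: leq_trans (leq_maxl k 1); apply: leq_trans dp.
  apply/subset_leq_card/fintype.subsetP => c; rewrite !inE inside_mirror -pE => ic.
  exact/interior_rect_set.
have inVs : (exists s, p \in vs s) -> p \in vs (false, false) ++ vs (false, true) ++
    vs (true, false) ++ vs (true, true) ++ cs.
  by move=> [[[] []]] h; rewrite !mem_cat h ?orbT.
rewrite -!mem_cat.
have [gpx gpy] := gpF i j ij.
(* Away from corners, two parallel open sides through [p] contradict general position, and two
   perpendicular ones form a crossing. *)
have [ci|[xi yi]|[yi xi]] := boundary_cases bi; first by rewrite !mem_cat (cornerP _ ci) !orbT.
all: have [cj|[xj yj]|[yj xj]] := boundary_cases bj; first by rewrite !mem_cat (cornerP _ cj) !orbT.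
- by have := gpx _ xi xj; lra.
- exact/inVs/(crossP j i).
- exact/inVs/(crossP i j).
- by have := gpy _ yi yj; lra.
Qed.

(* For k >= 1 we have maxn k 1 = k, so the first bound is O(k n + k^2 nu^2).
   That expression vanishes at k = 0, where the bound is O(n + nu^2).
   Here A #<= `I_m says that A has at most m elements. *)
Theorem theorem1 (R : realType) :
  exists C : nat, forall (n : nat) (F : 'I_n -> rectangle R),
    general_position F ->
    (forall k : nat,
       level_vertices F k #<=
         `I_(C * (maxn k 1 * n + maxn k 1 ^ 2 * packing_number F ^ 2))%N) /\
    union_vertices F #<= `I_(C * (n + packing_number F ^ 2))%N.
Proof.
exists 36 => n F gp; split=> [k|]; first exact: level_vertices_bound.
have := level_vertices_bound 0 gp; rewrite max0n mul1n exp1n mul1n.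
apply: card_le_trans; apply: subset_card_le => p [pv pd]; split=> //.
by rewrite pd.
Qed.
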